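(* For every $n,\ell\in\mathbb{N}$, every $\alpha>0$, every finite totally ordered set $X$, and every $\delta\le\ell^2/(1500n^2)$, any $(\varepsilon=\frac12,\delta)$-differentially private and $(\alpha,\beta=\frac18)$-accurate proper PAC learner for $\mathrm{THRESH}_X^\ell$ with sample complexity $n$ must have $n=\Omega(\frac{\ell}{\alpha}\log^*|X|)$.
   Context: For a totally ordered $X$ and $\vec a=(a_1,\dots,a_\ell)\in X^\ell$, $c_{\vec a}:X^\ell\to\{0,1\}$ has $c_{\vec a}(\vec x)=1$ iff $x_i\le a_i$ for all $1\le i\le\ell$; $\mathrm{THRESH}_X^\ell=\{c_{\vec a}:\vec a\in X^\ell\}$. An $(\alpha,\beta)$-accurate PAC learner for a concept class $C$ over domain $Z$ with sample complexity $n$: for every $c\in C$ and distribution $\mathcal{D}$ on $Z$, given $n$ examples $(z_i,c(z_i))$ with $z_i$ i.i.d. from $\mathcal{D}$, it outputs $h$ with $\Pr[\Pr_{z\sim\mathcal{D}}[h(z)\ne c(z)]\le\alpha]\ge1-\beta$; proper means $h\in C$. $(\varepsilon,\delta)$-differential privacy: for all labeled databases differing in one row and all output sets $T$, $\Pr[A(D)\in T]\le e^\varepsilon\Pr[A(D')\in T]+\delta$. $\log^*$ is the iterated base-2 logarithm.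
   Formalization: The bound is stated for 0 < α ≤ α0 with a universal constant α0 > 0 instead of every α > 0: for α ≥ 1 a constant learner with no examples is private and accurate, so the claim with a universal constant in Ω is false there. *)

(* Defs.v *)
From HB Require Import structures.
From mathcomp Require Import all_boot all_order all_algebra.
From mathcomp Require Import all_classical all_reals all_analysis.

Set Implicit Arguments.
Unset Strict Implicit.
Unset Printing Implicit Defensive.

Import Order.TTheory GRing.Theory Num.Theory.
Local Open Scope ring_scope.

Fixpoint logstar_fuel (R : realType) (k : nat) (x : R) : nat :=
  match k with
  | 0 => 0
  | k'.+1 => if x <= 1 then 0 else (logstar_fuel k' (ln x / ln 2)).+1
  end.

(* log* of a natural number N; fuel N suffices since log* N <= N. *)
Definition logstar (R : realType) (N : nat) : nat := logstar_fuel N (N%:R : R).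

Definition thresh (d : Order.disp_t) (T : finOrderType d) (l : nat)
  (a : {ffun 'I_l -> T}) : {ffun {ffun 'I_l -> T} -> bool} :=
  [ffun x : {ffun 'I_l -> T} => [forall i, (x i <= a i)%O]].

Definition THRESH (d : Order.disp_t) (T : finOrderType d) (l : nat)
  : pred {ffun {ffun 'I_l -> T} -> bool} :=
  fun h => [exists a, h == thresh a].

Definition is_pmf (R : realType) (A : finType) (p : {ffun A -> R}) : Prop :=
  (forall a, 0 <= p a) /\ \sum_(a : A) p a = 1.

Definition database (Z : finType) (n : nat) := {ffun 'I_n -> Z * bool}.

Definition learner (R : realType) (Z : finType) (n : nat) :=
  database Z n -> {ffun {ffun Z -> bool} -> R}.

Definition learner_randomized (R : realType) (Z : finType) (n : nat) (L : learner R Z n) : Prop :=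
  forall S, is_pmf (L S).

Definition learner_proper (R : realType) (Z : finType) (n : nat)
  (C : pred {ffun Z -> bool}) (L : learner R Z n) : Prop :=
  forall S h, 0 < L S h -> C h.

Definition error (R : realType) (Z : finType) (D : {ffun Z -> R})
  (c h : {ffun Z -> bool}) : R :=
  \sum_(z | h z != c z) D z.

Definition learner_accurate (R : realType) (Z : finType) (n : nat)
  (C : pred {ffun Z -> bool}) (L : learner R Z n) (alpha beta : R) : Prop :=
  forall c, C c -> forall D : {ffun Z -> R}, is_pmf D ->
    1 - beta <=
    \sum_(zs : {ffun 'I_n -> Z})
       (\prod_(i < n) D (zs i)) *
       (\sum_(h | error D c h <= alpha) L [ffun i => (zs i, c (zs i))] h).

Definition neighbors (Z : finType) (n : nat) (S S' : database Z n) : Prop :=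
  exists i : 'I_n, forall j, j != i -> S j = S' j.

Definition diff_private (R : realType) (Z : finType) (n : nat)
  (eps delta : R) (L : learner R Z n) : Prop :=
  forall S S' : database Z n, neighbors S S' ->
    forall O : {set {ffun Z -> bool}},
      \sum_(h in O) L S h <= expR eps * \sum_(h in O) L S' h + delta.

(* Main.v *)
(* A learner run on samples carried mostly by the coordinate axes must, on most axes,
   place its threshold between the two label classes of that axis, where it sees about
   n alpha / l examples; so it suffices to make this hard on one axis with M rows.  The
   hard instance is built by iterated b-adic blocks: given M values x_i, draw a uniform
   y < b^S, add the row y, and replace x_i by the lower or upper end of the block of
   size b^(x_i) around y.  An output a between the extreme rows has a well-defined
   exponent e at which the blocks of a and y first coincide, and e then lies between the
   extreme x_i unless a reproduces a digit of y which only the new row reveals.  By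
   privacy that happens with probability O(1/b + delta), and M levels exhaust a domain of
   size a tower of height O(M).  Sampling with replacement repeats a row r times; group
   privacy then costs 2^r, whose expectation is bounded.  When n alpha / l is below a
   constant, privacy is not used: one row per axis with a random label is rarely seen. *)
Require Import Defs.
From HB Require Import structures.
From mathcomp Require Import all_boot all_order all_algebra.
From mathcomp Require Import all_classical all_reals all_analysis.
From mathcomp Require Import zify ring lra.
Set Implicit Arguments.
Unset Strict Implicit.
Unset Printing Implicit Defensive.
Import Order.TTheory GRing.Theory Num.Theory.
Local Open Scope ring_scope.

(** * Domination by row-blind measures, and the block construction *)

(* Differential privacy with respect to row k alone, in the only form the argument needs:
   up to an additive D, p is bounded by a measure of mass at most K that ignores row k. *)
Definition dominated (R : realType) (J : eqType) (V : Type) (W : finType) (K D : R)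
    (p : (J -> V) -> W -> R) (k : J) : Prop :=
  exists q : (J -> V) -> W -> R,
  [/\ forall v w, 0 <= q v w, forall v, \sum_w q v w <= K,
      forall v v', (forall i, i != k -> v i = v' i) -> q v = q v' &
      forall v (E : pred W), \sum_(w | E w) p v w <= \sum_(w | E w) q v w + D].

Definition interior (M : nat) (v : nat -> nat) (a : nat) : bool :=
  [exists i : 'I_M, (v i <= a)%N] && [exists i : 'I_M, (a <= v i)%N].

Definition block_end (b : nat) (hi : bool) (y x : nat) : nat :=
  if hi then ((y %/ b ^ x).+1 * b ^ x).-1 else (y %/ b ^ x * b ^ x)%N.

(* Rows are numbered by the level at which they enter; even rows will be labelled true and
   odd rows false, whence the choice of the block end. *)
Definition extend (b M : nat) (x : nat -> nat) (y i : nat) : nat :=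
  if (i < M)%N then block_end b (odd i) y (x i) else if i == M then y else 0%N.

(** When no exponent below [S] works, [find] returns [S], so the value stays in the range of the
    exponents [x i] even for an [a] outside [[0, b ^ S)]. *)
Definition split_exponent (b S a y : nat) : nat :=
  find (fun e => a %/ b ^ e == y %/ b ^ e)%N (iota 0 S).

Fixpoint tower (b M : nat) : nat := if M is M'.+1 then (b ^ tower b M')%N else 1%N.

(** * Arithmetic of b-adic blocks *)

Lemma divn_expn_agree b u e a y : (u <= e)%N -> (a %/ b ^ u = y %/ b ^ u)%N ->
  (a %/ b ^ e = y %/ b ^ e)%N.
Proof. by move=> ue h; rewrite -(subnKC ue) expnD !divnMA h. Qed.

Lemma block_endP b hi y x e : (0 < b)%N -> (x <= e)%N ->
  (y %/ b ^ e * b ^ e <= block_end b hi y x < (y %/ b ^ e).+1 * b ^ e)%N.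
Proof.
move=> b0 xe; have x0 : (0 < b ^ x)%N by rewrite expn_gt0 b0.
have e0 : (0 < b ^ e)%N by rewrite expn_gt0 b0.
have -> : (y %/ b ^ e = block_end b hi y x %/ b ^ e)%N; last first.
  by rewrite leq_trunc_div /= -ltn_divLR.
apply: (@divn_expn_agree b x) => //.
rewrite /block_end; case: hi; last by rewrite mulnK.
have := mulSn (y %/ b ^ x)%N (b ^ x)%N; rewrite [RHS]addnC => ->.
rewrite -subn1 -addnBA // divnMDl // [X in (_ + X)%N]divn_small ?addn0 //.
by rewrite subn1 ltn_predL.
Qed.

Lemma block_end_agree b hi y y' x : (y %/ b ^ x = y' %/ b ^ x)%N ->
  block_end b hi y x = block_end b hi y' x.
Proof. by rewrite /block_end => ->. Qed.

(** The witness is the least exponent, capped at [S] so that it exists for [M = 0]. It depends on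
    the old rows only, which fixes the digit to be guessed before [y] is drawn. *)
Lemma exists_min_rows (S M : nat) (x : nat -> nat) : exists u : nat,
  [/\ (u <= S)%N, forall i, (i < M)%N -> (u <= x i)%N &
      forall e, (u <= e)%N -> (S <= e)%N \/ exists2 i, (i < M)%N & (x i <= e)%N].
Proof.
elim: M => [|M [u [uS ux umin]]]; first by exists S; split=> // e; left.
exists (minn u (x M)); split; first by rewrite geq_min uS.
  move=> i; rewrite ltnS leq_eqVlt => /orP[/eqP->|/ux ui]; first exact: geq_minr.
  by rewrite geq_min ui.
move=> e; rewrite geq_min => /orP[/umin[|[i iM xi]]|xe]; first by left.
  by right; exists i => //; apply: ltnW.
by right; exists M.
Qed.

(** If every [x i] were below the split exponent [e], all rows would lie in the block of size
    [b ^ e.-1] around [y]; an [a] between them would lie there too, against the minimality of [e].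
    So some [x i] is at least [e], and [u <= e] supplies one that is at most [e]. *)
Lemma interior_extend b M S x y a u : (0 < b)%N -> (0 < S)%N ->
  (forall i, (i < M)%N -> (x i <= S)%N) ->
  (forall e, (u <= e)%N -> (S <= e)%N \/ exists2 i, (i < M)%N & (x i <= e)%N) ->
  interior M.+1 (extend b M x y) a ->
  interior M x (split_exponent b S a y) || (split_exponent b S a y < u)%N.
Proof.
move=> b0 S0 xS umin; set e := split_exponent _ _ _ _ => /andP[/existsP[i0 h0] /existsP[i1 h1]].
case: (leqP u e) => [ue|_]; last by rewrite orbT.
rewrite orbF.
have [i iM ei] : exists2 i, (i < M)%N & (e <= x i)%N.
  case: (boolP [exists i : 'I_M, (e <= x i)%N]) => [/existsP[i ?]|/existsPn hn]; first by exists i.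
  have xlt i : (i < M)%N -> (x i < e)%N by move=> iM; have := hn (Ordinal iM); rewrite /= -ltnNge.
  have e0 : (0 < e)%N.
    by case: (umin _ ue) => [|[i iM _]]; [apply: leq_trans | apply: leq_trans (xlt i iM)].
  have := @before_find _ 0%N (fun e => a %/ b ^ e == y %/ b ^ e)%N (iota 0 S) e.-1.
  rewrite -/(split_exponent _ _ _ _) -/e prednK // leqnn => /(_ isT).
  have eS : (e <= S)%N by rewrite -[X in (_ <= X)%N](size_iota 0) find_size.
  rewrite nth_iota ?add0n; last by rewrite prednK.
  have B0 : (0 < b ^ e.-1)%N by rewrite expn_gt0 b0.
  have inblock i : (i < M.+1)%N ->
      (y %/ b ^ e.-1 * b ^ e.-1 <= extend b M x y i < (y %/ b ^ e.-1).+1 * b ^ e.-1)%N.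
    rewrite ltnS leq_eqVlt /extend => /orP[/eqP->|iM].
      by rewrite ltnn eqxx leq_trunc_div -ltn_divLR /=.
    by rewrite iM block_endP // -ltnS prednK // xlt.
  have /andP[l0 _] := inblock i0 (ltn_ord i0).
  have /andP[_ l1] := inblock i1 (ltn_ord i1).
  suff -> : (a %/ b ^ e.-1 == y %/ b ^ e.-1)%N by [].
  rewrite eqn_leq -ltnS ltn_divLR // leq_divRL // (leq_trans l0 h0).
  by rewrite (leq_ltn_trans h1 l1).
apply/andP; split; apply/existsP; last by exists (Ordinal iM).
case: (umin _ ue) => [Se|[k kM ke]]; last by exists (Ordinal kM).
by exists (Ordinal iM) => /=; apply: leq_trans (xS _ iM) Se.
Qed.

(** Agreement at an exponent below [u] persists up to [u.-1]. Blocks of size at least [b ^ u] do not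
    determine the quotient of [y] there, so [a] has guessed a hidden digit. *)
Lemma split_exponent_lt b S a y u : (u <= S)%N -> (split_exponent b S a y < u)%N ->
  (a %/ b ^ u.-1 = y %/ b ^ u.-1)%N.
Proof.
move=> uS; set e := split_exponent _ _ _ _ => eu.
have eS : (e < S)%N by apply: leq_trans eu uS.
have := eS; rewrite -[X in (_ < X)%N](size_iota 0) -has_find => /(nth_find 0%N).
rewrite -/(split_exponent b S a y) -/e nth_iota // add0n => /eqP.
by apply: divn_expn_agree; case: u eu {uS}.
Qed.

(** * Guessing a hidden digit, and the induction on levels *)

Lemma card_div_class (B N c : nat) : (0 < B)%N -> (#|[pred y : 'I_N | y %/ B == c]| <= B)%N.
Proof.
move=> B0; rewrite -[X in (_ <= X)%N]card_ord.
pose f (y : 'I_N) := Ordinal (ltn_pmod y B0).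
rewrite -(@card_in_image _ _ f) ?max_card // => y y'; rewrite !inE => /eqP h /eqP h' [] hm.
by apply: val_inj; rewrite /= (divn_eq y B) h hm -h' -divn_eq.
Qed.

(** The measure [f y] is constant on classes of [b ^ u.+1] values of [y], and a fixed outcome
    matches at most [b ^ u] values in a class: a fraction [1 / b]. *)
Lemma sum_guess_digit (R : realType) (W : finType) (b S u : nat) (K : R)
    (f : nat -> W -> R) (out : W -> nat) :
  (0 < b)%N -> (u < S)%N -> (forall y w, 0 <= f y w) -> (forall y, \sum_w f y w <= K) ->
  (forall y y', (y %/ b ^ u.+1 = y' %/ b ^ u.+1)%N -> f y = f y') ->
  \sum_(y < (b ^ S)%N) \sum_(w | (out w %/ b ^ u == y %/ b ^ u)%N) f y w
    <= (b ^ S)%:R * (K / b%:R).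
Proof.
move=> b0 uS f0 fK fE.
have bu m : (0 < b ^ m)%N by rewrite expn_gt0 b0.
have cls (y : 'I_(b ^ S)) : (y %/ b ^ u.+1 < b ^ (S - u.+1))%N.
  by rewrite ltn_divLR // -expnD subnK.
rewrite (partition_big (fun y => Ordinal (cls y)) xpredT) //=.
apply: (@le_trans _ _ (\sum_(c < (b ^ (S - u.+1))%N) (b ^ u)%:R * K)); last first.
  rewrite sumr_const card_ord -[_ *+ _]mulr_natl mulrA -natrM -expnD.
  have bS : (b ^ S)%:R = b%:R * (b ^ (S - u.+1 + u))%:R :> R.
    rewrite -natrM -expnS; congr ((b ^ _)%:R); lia.
  have b_neq0 : b%:R != 0 :> R by rewrite pnatr_eq0 -lt0n.
  by rewrite bS le_eqVlt; apply/orP; left; apply/eqP; field.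
apply: ler_sum => c _.
rewrite (eq_bigr (fun y : 'I_(b ^ S) =>
  \sum_w f (c * b ^ u.+1)%N w * ((out w %/ b ^ u == y %/ b ^ u)%N)%:R)); last first.
  move=> y /eqP yc; rewrite big_mkcond; apply: eq_bigr => w _.
  rewrite (fE y (c * b ^ u.+1)%N); last by rewrite mulnK // -yc.
  by case: ifP; rewrite ?mulr1 ?mulr0.
rewrite exchange_big /=.
apply: (@le_trans _ _ (\sum_w f (c * b ^ u.+1)%N w * (b ^ u)%:R)); last first.
  by rewrite -mulr_suml mulrC ler_wpM2l.
apply: ler_sum => w _; rewrite -mulr_sumr ler_wpM2l //.
apply: (@le_trans _ _ (\sum_(y < (b ^ S)%N) ((y %/ b ^ u == out w %/ b ^ u)%N)%:R)).
  rewrite big_mkcond; apply: ler_sum => y _.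
  by case: ifP => _; rewrite ?ler0n // eq_sym.
rewrite -natr_sum ler_nat -big_mkcond sum1_card /=; exact: card_div_class.
Qed.

Lemma sum_pair_pred (R : realType) (U W : finType) (E : pred (U * W)) (F : U * W -> R) :
  \sum_(x | E x) F x = \sum_u \sum_(w | E (u, w)) F (u, w).
Proof. by rewrite pair_big_dep; apply: eq_big => -[]. Qed.

(** Auxiliary randomness [u] becomes part of the outcome. Sums over it are not normalised, hence the
    factors [#|U|]. *)
Lemma dominated_sum (R : realType) (J J' : eqType) (V V' : Type) (W U : finType) (K D : R)
    (p : (J -> V) -> W -> R) (k : J) (k' : J') (g : (J' -> V') -> U -> J -> V) :
  dominated K D p k ->
  (forall v v' u, (forall i, i != k' -> v i = v' i) ->
     forall i, i != k -> g v u i = g v' u i) ->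
  dominated (#|U|%:R * K) (#|U|%:R * D)
    (fun v (uw : U * W) => p (g v uw.1) uw.2) k'.
Proof.
move=> [q [q0 qK qk qE]] gk.
exists (fun v uw => q (g v uw.1) uw.2); split=> //.
- move=> v; rewrite sum_pair_pred /=.
  by rewrite -sumr_const mulr_suml; apply: ler_sum => u _; rewrite mul1r.
- by move=> v v' vv'; apply/funext => uw; rewrite (qk _ _ (gk v v' uw.1 vv')).
- move=> v E; rewrite !sum_pair_pred /=.
  rewrite -sumr_const mulr_suml -big_split; apply: ler_sum => u _ /=; rewrite mul1r.
  exact: qE.
Qed.

(** Induction on [M]: the values of one level are the exponents of the next, so the range grows from
    [S] to [b ^ S], and each level costs one guess, [K / b + D]. Keeping even rows at or below [top]
    and odd rows at or above makes [top] a consistent threshold. *)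
Lemma interior_hard (R : realType) (b M : nat) : (0 < b)%N ->
  exists (Y : finType) (v : Y -> nat -> nat) (top : Y -> nat),
  [/\ (0 < #|Y|)%N, forall y, (top y < tower b M)%N,
      forall y i, (i < M)%N -> (v y i < tower b M)%N /\
        (if odd i then top y <= v y i else v y i <= top y)%N &
      forall (W : finType) (p : (nat -> nat) -> W -> R) (out : W -> nat) (K D : R),
        (forall v w, 0 <= p v w) ->
        (forall k, (k < M)%N -> dominated K D p k) ->
        \sum_y \sum_(w | interior M (v y) (out w)) p (v y) w
          <= #|Y|%:R * (M%:R * (K / b%:R + D))].
Proof.
move=> b0; elim: M => [|M [Y [v [top [Y0 topS vS IH]]]]].
  exists unit, (fun _ _ => 0%N), (fun _ => 0%N); split=> // [|W p out K D _ _].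
    by rewrite card_unit.
  rewrite mul0r mulr0 big1 // => y _; rewrite big_pred0 // => w.
  by apply/negbTE; rewrite negb_and; apply/orP; left; apply/existsPn => -[].
set S := tower b M in topS vS *.
have bS : (0 < b ^ S)%N by rewrite expn_gt0 b0.
have S0 : (0 < S)%N by rewrite /S; case: (M) => //= m; rewrite expn_gt0 b0.
have xS y i : (i < M)%N -> (v y i <= S)%N by move=> /(vS y)[/ltnW].
exists (Y * 'I_(b ^ S))%type, (fun yz : Y * 'I_(b ^ S) => extend b M (v yz.1) yz.2),
  (fun yz : Y * 'I_(b ^ S) => yz.2 : nat).
split.
- by rewrite card_prod card_ord muln_gt0 Y0.
- by move=> -[y z] /=; apply: ltn_ord.
- move=> [y z] i /=; rewrite ltnS leq_eqVlt /extend => /orP[/eqP->|iM].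
    by rewrite ltnn eqxx ltn_ord; case: odd.
  have x0 : (0 < b ^ v y i)%N by rewrite expn_gt0 b0.
  rewrite iM; split; last first.
    rewrite /block_end; case: odd; last exact: leq_trunc_div.
    by rewrite -ltnS prednK ?muln_gt0 ?x0 // -ltn_divLR.
  have /andP[_] := @block_endP b (odd i) z (v y i) S b0 (xS _ _ iM).
  by rewrite divn_small // mul1n.
move=> W p out K D p0 pdom.
rewrite sum_pair_pred /=.
pose e (z : 'I_(b ^ S)) w := split_exponent b S (out w) z.
(* The induction hypothesis is applied to the procedure that draws [z], extends the rows and returns
   the split exponent. *)
have int0 : \sum_y \sum_z \sum_(w | interior M (v y) (e z w)) p (extend b M (v y) z) w
    <= #|Y|%:R * (M%:R * ((b ^ S)%:R * K / b%:R + (b ^ S)%:R * D)).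
  have := IH _ (fun v (zw : 'I_(b ^ S) * W) => p (extend b M v zw.1) zw.2)
    (fun zw => e zw.1 zw.2) ((b ^ S)%:R * K) ((b ^ S)%:R * D) (fun _ _ => p0 _ _).
  under eq_bigr => y _ do rewrite sum_pair_pred /=.
  apply=> k kM; rewrite -[X in (X%:R)](card_ord (b ^ S)).
  apply: (@dominated_sum _ _ _ _ _ _ _ _ _ _ k k (fun v (z : 'I_(b ^ S)) => extend b M v z)).
    exact/pdom/ltnW.
  by move=> x x' z xx' i ik; rewrite /extend; case: ifP => // _; rewrite xx'.
have bad y : exists2 u : nat,
    forall (z : 'I_(b ^ S)) w, interior M.+1 (extend b M (v y) z) (out w) ->
       interior M (v y) (e z w) || (e z w < u)%N &
    \sum_(z < (b ^ S)%N) \sum_(w | (e z w < u)%N) p (extend b M (v y) z) w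
      <= (b ^ S)%:R * (K / b%:R + D).
  have [u [uS uv umin]] := exists_min_rows S M (v y).
  exists u; first by move=> z w; apply: interior_extend => // i; apply: xS.
  have [q [q0 qK qM qE]] := pdom M (ltnSn M).
  rewrite mulrDr -[X in _ + X%:R * _](card_ord (b ^ S)) -sumr_const mulr_suml.
  apply: (@le_trans _ _ (\sum_(z < (b ^ S)%N)
     (\sum_(w | (e z w < u)%N) q (extend b M (v y) z) w + D))).
    by apply: ler_sum => z _; apply: qE.
  rewrite big_split /= lerD //; last by under [leRHS]eq_bigr do rewrite mul1r.
  case: u uS uv {umin} => [|u] uS uv.
    rewrite big1 => [|z _]; last by rewrite big_pred0.
    rewrite mulr_ge0 ?divr_ge0 ?ler0n //.
    by apply: le_trans (qK (fun=> 0%N)); apply: sumr_ge0.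
  apply: (@le_trans _ _ (\sum_(z < (b ^ S)%N)
     \sum_(w | (out w %/ b ^ u == z %/ b ^ u)%N) q (extend b M (v y) z) w)).
    apply: ler_sum => z _; rewrite big_mkcond [leRHS]big_mkcond; apply: ler_sum => w _.
    case: ifP => [/(split_exponent_lt uS) /= -> //|_]; first by rewrite eqxx.
    by case: ifP.
  (* Old exponents are at least [u.+1], so with the new row ignored by [q] the data depend on [z]
     only through its quotient by [b ^ u.+1]. *)
  apply: (@sum_guess_digit _ _ _ _ _ _ (fun z w => q (extend b M (v y) z) w)) => // z z' zz'.
  apply/funext => w; rewrite (qM _ (extend b M (v y) z')) // => i iM.
  rewrite /extend (negbTE iM); case: ifP => // {}iM; apply: block_end_agree.
  exact: divn_expn_agree (uv _ iM) zz'.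
have -> : #|{: Y * 'I_(b ^ S)}|%:R * (M.+1%:R * (K / b%:R + D)) =
    #|Y|%:R * (M%:R * ((b ^ S)%:R * K / b%:R + (b ^ S)%:R * D))
    + \sum_(y : Y) (b ^ S)%:R * (K / b%:R + D) :> R.
  by rewrite card_prod card_ord sumr_const -[_ *+ _]mulr_natl natrM -natr1; ring.
apply: le_trans (lerD int0 (lexx _)).
rewrite -big_split; apply: ler_sum => y _ /=.
have [u ubad usum] := bad y.
apply: le_trans (lerD (lexx _) usum).
rewrite -big_split; apply: ler_sum => z _ /=.
rewrite big_mkcond [X in _ <= X + _]big_mkcond [X in _ <= _ + X]big_mkcond -big_split.
apply: ler_sum => w _ /=; have := ubad z w; have := p0 (extend b M (v y) z) w.
case: ifP => _; case: ifP => _; case: ifP => _ p_ge0 h;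
  by rewrite ?addr0 ?add0r ?lerDl ?addr_ge0 //; have := h isT.
Qed.

Lemma dominated_comp (R : realType) (J J' : eqType) (V V' : Type) (W : finType) (K D : R)
    (p : (J -> V) -> W -> R) (k : J) (k' : J') (g : (J' -> V') -> J -> V) :
  dominated K D p k ->
  (forall v v', (forall i, i != k' -> v i = v' i) -> forall i, i != k -> g v i = g v' i) ->
  dominated K D (fun v => p (g v)) k'.
Proof.
move=> [q [q0 qK qk qE]] gk; exists (fun v => q (g v)).
by split=> // v v' vv'; apply/qk/gk.
Qed.

(** * Hard distributions on one axis and on a product of axes *)

(** The inequality is strict so that, with labels evenly split, misclassifying one whole label class
    is already not good. *)
Definition axis_good (d : Order.disp_t) (T : finOrderType d) (M : nat)
    (D : 'I_M -> T * bool) (a : T) : bool :=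
  (2 * #|[pred i | ((D i).1 <= a)%O != (D i).2]| < M)%N.

Definition axis_labelled (d : Order.disp_t) (T : finOrderType d) (M : nat)
    (D : 'I_M -> T * bool) (a : T) : Prop :=
  forall i, (D i).2 = ((D i).1 <= a)%O.

(** [K] and [De] stay free because the two sampling bounds supply different pairs: [(4, 4 * delta)]
    and [(1, n * w k)]. *)
Definition hard_axis (R : realType) (d : Order.disp_t) (T : finOrderType d) (M : nat)
    (beta gamma : R) (Y : finType) (D : Y -> 'I_M -> T * bool) : Prop :=
  forall (W : finType) (p : ('I_M -> T * bool) -> W -> R) (out : W -> T) (K De : R),
    (forall v w, 0 <= p v w) -> (forall k, dominated K De p k) ->
    \sum_y \sum_(w | axis_good (D y) (out w)) p (D y) w
      <= #|Y|%:R * (beta * K + gamma * De).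

Lemma ranking (d : Order.disp_t) (T : finOrderType d) : (0 < #|T|)%N ->
  exists (t : nat -> T) (rank : T -> nat),
    (forall i, (i < #|T|)%N -> rank (t i) = i) /\
    (forall x y, (x <= y)%O = (rank x <= rank y)%N).
Proof.
move=> T0; exists (fun i => Order.enum_val (odflt (Ordinal T0) (insub i))).
exists (fun x => Order.enum_rank x : nat); split=> [i iT|x y].
  by rewrite Order.enum_valK insubT.
by rewrite -Order.le_enum_rank.
Qed.

(** A measure that ignores the only row is the same for both labels, and the two good events are
    complementary, so their masses add up to at most [K]. *)
Lemma hard_axis_single (R : realType) (d : Order.disp_t) (T : finOrderType d) :
  (1 < #|T|)%N ->
  exists (D : bool -> 'I_1 -> T * bool) (c : bool -> T),
    (forall y, axis_labelled (D y) (c y)) /\ hard_axis (1 / 2 : R) 1 D.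
Proof.
move=> T1; have [t [rank [rankK rankE]]] := ranking (ltnW T1).
exists (fun y _ => (t 1%N, y)), (fun y => t (y : nat)); split=> [y i|W p out K De p0 pdom] /=.
  by rewrite rankE !rankK //; case: y => //; apply: ltnW.
have [q [q0 qK qk qE]] := pdom ord0.
pose D (y : bool) (_ : 'I_1) := (t 1%N, y).
have goodE y a : axis_good (D y) a = ((t 1%N <= a)%O == y).
  rewrite /axis_good /= -sum1_card big_mkcond big_ord1 /= inE.
  by case: eqP.
have qD y : q (D y) = q (D true) by apply: qk => i; rewrite (ord1 i).
apply: (@le_trans _ _ (\sum_y (\sum_(w | axis_good (D y) (out w)) q (D true) w + De))).
  by apply: ler_sum => y _; rewrite -(qD y) qE.
rewrite big_split /= sumr_const card_bool -mulr_natl.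
rewrite big_bool /= (eq_bigl (fun w => (t 1%N <= out w)%O)); last first.
  by move=> w; rewrite goodE eqb_id.
rewrite [X in _ + X + _](eq_bigl (fun w => ~~ (t 1%N <= out w)%O)); last first.
  by move=> w; rewrite goodE eqbF_neg.
have := qK (D true); rewrite (bigID (fun w => (t 1%N <= out w)%O)) /= => hK.
lra.
Qed.

Lemma card_parity m (c : bool) : #|[pred i : 'I_(2 * m) | odd i == c]| = m.
Proof.
rewrite -sum1_card big_mkcond /=; elim: m => [|m IH]; first by rewrite big_ord0.
rewrite mulnS !big_ord_recr /= IH !inE /= oddM /=.
by case: c {IH}; rewrite ?addn0 addn1.
Qed.

(** An output below all rows errs on the [m] even ones, an output above all rows on the [m] odd
    ones, so a good output is interior. The strict bound on [#|T|] leaves room for shifting the odd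
    rows. *)
Lemma hard_axis_tower (R : realType) (d : Order.disp_t) (T : finOrderType d) (b m : nat) :
  (0 < b)%N -> (0 < m)%N -> (tower b (2 * m) < #|T|)%N ->
  exists (Y : finType) (D : Y -> 'I_(2 * m) -> T * bool) (c : Y -> T),
    [/\ (0 < #|Y|)%N, forall y, axis_labelled (D y) (c y) &
        hard_axis ((2 * m)%:R / b%:R : R) (2 * m)%:R D].
Proof.
move=> b0 m0 bT; have [t [rank [rankK rankE]]] := ranking (leq_ltn_trans (leq0n _) bT).
have [Y [v [top [Y0 topS vS vhard]]]] := @interior_hard R b (2 * m) b0.
(* Upper block ends are inclusive, so false rows are shifted by one to lie above the
   threshold. *)
pose row (x : nat -> nat) (i : 'I_(2 * m)) := (t (x i + odd i)%N, ~~ odd i).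
exists Y, (fun y => row (v y)), (fun y => t (top y)).
have rankrow y (i : 'I_(2 * m)) : rank (t (v y i + odd i)%N) = (v y i + odd i)%N.
  have [+ _] := vS y i (ltn_ord i) => vlt; apply: rankK; apply: leq_ltn_trans bT.
  by case: odd; rewrite ?addn0 ?addn1 // ltnW.
split=> // [y i /=|W p out K De p0 pdom].
  rewrite rankE rankrow rankK; last exact: ltn_trans (topS y) bT.
  have [_] := vS y i (ltn_ord i).
  by case: odd => /= h; rewrite ?addn0 ?h // addn1 leqNgt ltnS h.
have goodI y a : axis_good (row (v y)) a -> interior (2 * m) (v y) (rank a).
  rewrite /axis_good ltn_pmul2l // => good; apply/andP; split.
    apply: contraLR good => /existsPn vhi; rewrite -leqNgt.
    apply: (@leq_trans #|[pred i : 'I_(2 * m) | odd i == false]|); first by rewrite card_parity.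
    apply: subset_leq_card; apply/fintype.subsetP => i; rewrite !inE /= rankE rankrow.
    by case: odd => //= _; rewrite addn0 (negbTE (vhi i)).
  apply: contraLR good => /existsPn vlo; rewrite -leqNgt.
    apply: (@leq_trans #|[pred i : 'I_(2 * m) | odd i == true]|); first by rewrite card_parity.
  apply: subset_leq_card; apply/fintype.subsetP => i; rewrite !inE /= rankE rankrow.
  by case: odd => //= _; rewrite addn1 ltnNge vlo.
have dom k : (k < 2 * m)%N -> dominated K De (fun x => p (row x)) k.
  move=> kM; apply: (@dominated_comp _ _ _ _ _ _ _ _ _ (Ordinal kM) k row) => // x x' xx' i ik.
  by rewrite /row xx'.
have := vhard W (fun x => p (row x)) (fun w => rank (out w)) K De (fun _ => p0 _) dom.
rewrite mulrDr mulrA mulrAC; apply: le_trans.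
apply: ler_sum => y _; rewrite big_mkcond [leRHS]big_mkcond; apply: ler_sum => w _.
by case: ifP => [/goodI ->|_] //; case: ifP.
Qed.

(** The instances on the other axes serve as internal randomness of a procedure that attacks axis
    [j] alone. *)
Lemma hard_axis_product (R : realType) (d : Order.disp_t) (T : finOrderType d) (M l : nat)
    (beta gamma : R) (Y : finType) (D : Y -> 'I_M -> T * bool) (W : finType)
    (P : ('I_l * 'I_M -> T * bool) -> W -> R) (out : W -> 'I_l -> T) (K De : R) (j : 'I_l) :
  (0 < #|Y|)%N -> hard_axis beta gamma D -> (forall v w, 0 <= P v w) ->
  (forall jk, dominated K De P jk) ->
  \sum_(e : {ffun 'I_l -> Y}) \sum_(w | axis_good (D (e j)) (out w j))
      P (fun jk => D (e jk.1) jk.2) w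
    <= #|{ffun 'I_l -> Y}|%:R * (beta * K + gamma * De).
Proof.
move=> Y0 hD P0 Pdom.
pose subst (e : {ffun 'I_l -> Y}) (x : 'I_M -> T * bool) (jk : 'I_l * 'I_M) :=
  if jk.1 == j then x jk.2 else D (e jk.1) jk.2.
have := hD _ (fun x (ew : {ffun 'I_l -> Y} * W) => P (subst ew.1 x) ew.2)
  (fun ew => out ew.2 j) (#|{ffun 'I_l -> Y}|%:R * K) (#|{ffun 'I_l -> Y}|%:R * De)
  (fun _ _ => P0 _ _).
have dom k : dominated (#|{ffun 'I_l -> Y}|%:R * K) (#|{ffun 'I_l -> Y}|%:R * De)
    (fun x (ew : {ffun 'I_l -> Y} * W) => P (subst ew.1 x) ew.2) k.
  apply: (@dominated_sum _ _ _ _ _ _ _ _ _ _ (j, k) k (fun x e => subst e x)) => //.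
  move=> x x' e xx' [j' k'] jk; rewrite /subst /=; case: eqP => // jj; apply: xx'.
  by apply: contraNneq jk => ->; rewrite jj.
move=> /(_ dom).
pose F (e : {ffun 'I_l -> Y}) :=
  \sum_(w | axis_good (D (e j)) (out w j)) P (fun jk => D (e jk.1) jk.2) w.
(* Resampling axis j is the involution exchanging the fresh value with the old one. *)
pose swap (ye : Y * {ffun 'I_l -> Y}) :=
  (ye.2 j, [ffun i => if i == j then ye.1 else ye.2 i]).
have swapK : involutive swap.
  move=> [y e]; rewrite /swap /= ffunE eqxx; congr (_, _); apply/ffunP => i.
  by rewrite !ffunE; case: eqP => // ->.
rewrite (_ : \sum_y _ = \sum_(ye : Y * {ffun 'I_l -> Y}) F (swap ye).2); last first.
  rewrite sum_pair_pred; apply: eq_bigr => y _; rewrite sum_pair_pred; apply: eq_bigr => e _.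
  rewrite /F /swap /= ffunE eqxx; apply: eq_bigr => w _; congr (P _ w); apply/funext => jk.
  by rewrite /subst ffunE; case: ifP.
rewrite -(@reindex_inj _ _ _ _ swap xpredT (fun ye => F ye.2) (inv_inj swapK)) /=.
rewrite sum_pair_pred /= sumr_const -[_ *+ _]mulr_natl.
have -> : #|Y|%:R * (beta * (#|{ffun 'I_l -> Y}|%:R * K)
    + gamma * (#|{ffun 'I_l -> Y}|%:R * De))
  = #|Y|%:R * (#|{ffun 'I_l -> Y}|%:R * (beta * K + gamma * De)) by ring.
by rewrite ler_pM2l // ltr0n.
Qed.

(** * Group privacy and sampling with replacement *)

Lemma expR_half_le2 (R : realType) : expR (1 / 2) <= 2 :> R.
Proof.
have := @expR_ge1Dx R (- (1 / 2)); have := @expR_gt0 R (1 / 2).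
have := @expRxMexpNx_1 R (1 / 2); nra.
Qed.

(* Adding delta on both sides turns f <= 2 f1 + delta into f + delta <= 2 (f1 + delta),
   which iterates without a geometric sum. *)
Lemma group_privacy (R : realType) (Z : finType) (n : nat) (delta : R) (L : learner R Z n)
    (A : {set 'I_n}) (S S' : database Z n) (O : {set {ffun Z -> bool}}) :
  learner_randomized L -> diff_private (1 / 2) delta L ->
  (forall i, i \notin A -> S i = S' i) ->
  \sum_(h in O) L S h + delta <= 2 ^+ #|A| * (\sum_(h in O) L S' h + delta).
Proof.
move=> Lr Lp; have [m] := ubnP #|A|; elim: m => // m IH in A S *.
rewrite ltnS => Am SS'; have [A0|[i iA]] := set_0Vmem A.
  suff -> : S = S' by rewrite A0 cards0 mul1r.
  by apply/ffunP => i; apply: SS'; rewrite A0 inE.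
pose S1 : database Z n := [ffun j => if j == i then S' j else S j].
have := Lp S S1 _ O; have Sn : neighbors S S1.
  by exists i => j ji; rewrite ffunE (negbTE ji).
move=> /(_ Sn); have := cardsD1 i A; rewrite iA => cA.
have := IH (A :\ i) S1 _ _; rewrite cA exprS -mulrA => IHA LS.
have {IHA} : \sum_(h in O) L S1 h + delta <= 2 ^+ #|A :\ i| * (\sum_(h in O) L S' h + delta).
  apply: IHA; first by move: Am; rewrite cA.
  move=> j; rewrite !inE negb_and negbK ffunE => /orP[->//|jA].
  by case: ifP => // _; apply: SS'.
have e2 := expR_half_le2 R.
have : 0 <= \sum_(h in O) L S1 h by apply: sumr_ge0 => h _; apply: (Lr S1).1.
move: LS; set s := \sum_(h in O) L S h; set s1 := \sum_(h in O) L S1 h => LS s10 IHA.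
have := ler_wpM2r s10 e2; lra.
Qed.

Section Sampling.
Variables (R : realType) (Z I : finType) (n : nat) (w : I -> R) (L : learner R Z n).
Hypotheses (w0 : forall o, 0 <= w o) (w1 : \sum_o w o = 1) (Lr : learner_randomized L).

(** Indices are drawn instead of points, so that the draw does not depend on the rows [x]. *)
Definition sample (x : I -> Z * bool) (fh : {ffun 'I_n -> I} * {ffun Z -> bool}) : R :=
  (\prod_i w (fh.1 i)) * L [ffun i => x (fh.1 i)] fh.2.

Lemma sample_ge0 x fh : 0 <= sample x fh.
Proof. by rewrite mulr_ge0 ?prodr_ge0 //; apply: (Lr _).1. Qed.

Lemma sum_prod_ffun (f : I -> R) :
  \sum_(g : {ffun 'I_n -> I}) \prod_i f (g i) = (\sum_o f o) ^+ n.
Proof.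
by rewrite -(bigA_distr_bigA (fun _ : 'I_n => f)) prodr_const card_ord.
Qed.

(** The dominating measure overwrites row [k] by [z0] and weighs each draw by 2 to the number of
    hits of [k]. Its mass is [(1 + w k) ^+ n], at most [expR 1 <= 4], and the same factor multiplies
    [delta]. *)
Lemma dominated_sample_private (delta : R) (z0 : Z * bool) (k : I) :
  0 <= delta -> diff_private (1 / 2) delta L -> n%:R * w k <= 1 ->
  dominated 4 (4 * delta) sample k.
Proof.
move=> d0 Lp nw.
pose x' (x : I -> Z * bool) o := if o == k then z0 else x o.
pose hits (f : {ffun 'I_n -> I}) : R := \prod_i (if f i == k then 2 else 1).
have hits_ge0 f : 0 <= hits f by apply: prodr_ge0 => i _; case: ifP.
have W0 (f : {ffun 'I_n -> I}) : 0 <= \prod_i w (f i) by apply: prodr_ge0.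
have mass : \sum_(f : {ffun 'I_n -> I}) (\prod_i w (f i)) * hits f <= 4.
  under eq_bigr => f _ do rewrite -big_split /=.
  rewrite (sum_prod_ffun (fun o => w o * (if o == k then 2 else 1))).
  have -> : \sum_o w o * (if o == k then 2 else 1) = 1 + w k.
    have := w1; rewrite (bigD1 k) //= [in X in _ -> X](bigD1 k) //= eqxx => w1k.
    rewrite (eq_bigr w); last by move=> o /negbTE ->; rewrite mulr1.
    lra.
  apply: (@le_trans _ _ (expR (w k) ^+ n)).
    by rewrite lerXn2r ?nnegrE ?addr_ge0 ?expR_ge0 // expR_ge1Dx.
  rewrite -expRM_natl; apply: (@le_trans _ _ (expR 1)); first by rewrite ler_expR.
  have -> : 1 = 1 / 2 + 1 / 2 :> R by lra.
  rewrite expRD; have := expR_half_le2 R; have := @expR_gt0 R (1 / 2); nra.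
exists (fun x (fh : {ffun 'I_n -> I} * {ffun Z -> bool}) =>
  (\prod_i w (fh.1 i)) * hits fh.1 * L [ffun i => x' x (fh.1 i)] fh.2).
split.
- by move=> x fh; rewrite !mulr_ge0 //; apply: (Lr _).1.
- move=> x; rewrite sum_pair_pred /=; apply: le_trans mass; apply: ler_sum => f _.
  by rewrite -mulr_sumr (Lr _).2 mulr1.
- move=> v v' vv'; suff -> : x' v = x' v' by [].
  by apply/funext => o; rewrite /x'; case: eqP => // /eqP /vv'.
- move=> x E; rewrite !sum_pair_pred /=.
  apply: (@le_trans _ _ (\sum_(f : {ffun 'I_n -> I}) ((\prod_i w (f i)) * hits f *
      \sum_(h | E (f, h)) L [ffun i => x' x (f i)] h + (\prod_i w (f i)) * hits f * delta))).
    apply: ler_sum => f _; rewrite /sample /= -mulr_sumr -mulrDr -mulrA ler_wpM2l //.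
    have := @group_privacy _ _ _ _ _ [set i | f i == k] [ffun i => x (f i)]
      [ffun i => x' x (f i)] [set h | E (f, h)] Lr Lp.
    have inE' F : \sum_(h in [set h | E (f, h)]) F h = \sum_(h | E (f, h)) F h :> R.
      by apply: eq_bigl => h; rewrite inE.
    rewrite !inE'.
    have -> : 2 ^+ #|[set i | f i == k]| = hits f.
      by rewrite -prodr_const big_mkcond; apply: eq_bigr => i _; rewrite inE.
    move=> G; apply: le_trans (G _); first by rewrite lerDl.
    by move=> i; rewrite inE !ffunE /x' => /negbTE ->.
  rewrite big_split lerD //=; first by apply: ler_sum => f _; rewrite mulr_sumr.
  by rewrite -mulr_suml ler_wpM2r.
Qed.

(** Only draws that miss [k] are kept; by Bernoulli's inequality the others have mass at most
    [n * w k]. *)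
Lemma dominated_sample_rare (k : I) : dominated 1 (n%:R * w k) sample k.
Proof.
pose miss (f : {ffun 'I_n -> I}) : bool := [forall i, f i != k].
have W0 (f : {ffun 'I_n -> I}) : 0 <= \prod_i w (f i) by apply: prodr_ge0.
have wk1 : w k <= 1 by rewrite -w1 (bigD1 k) //= lerDl sumr_ge0.
have total : \sum_(f : {ffun 'I_n -> I}) \prod_i w (f i) = 1.
  by rewrite sum_prod_ffun w1 expr1n.
have hit : \sum_(f : {ffun 'I_n -> I} | ~~ miss f) \prod_i w (f i) <= n%:R * w k.
  suff : 1 - n%:R * w k <= \sum_(f : {ffun 'I_n -> I} | miss f) \prod_i w (f i).
    by move: total; rewrite (bigID miss) /=; lra.
  rewrite big_mkcond (eq_bigr (fun f : {ffun 'I_n -> I} =>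
      \prod_i (if f i == k then 0 else w (f i)))); last first.
    move=> f _; case: ifP => [/forallP fk|/negbT/forallPn[i]].
      by apply: eq_bigr => i _; rewrite (negbTE (fk i)).
    by rewrite negbK => fk; rewrite (bigD1 i) //= fk mul0r.
  rewrite (sum_prod_ffun (fun o => if o == k then 0 else w o)).
  have -> : \sum_o (if o == k then 0 else w o) = 1 - w k.
    have := w1; rewrite (bigD1 k) //= [in X in _ -> X](bigD1 k) //= eqxx => w1k.
    rewrite (eq_bigr w); last by move=> o /negbTE ->.
    lra.
  elim: (n) => [|m IH]; first by rewrite expr0 mul0r subr0.
  have wk0 := w0 k; have : (0 : R) <= m%:R by [].
  rewrite exprS -natr1; nra.
exists (fun x (fh : {ffun 'I_n -> I} * {ffun Z -> bool}) =>
  if miss fh.1 then sample x fh else 0); split.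
- by move=> x fh; case: ifP => // _; apply: sample_ge0.
- move=> x; rewrite sum_pair_pred /= -total; apply: ler_sum => f _.
  case: (miss f) => /=; last by rewrite big1 // prodr_ge0.
  by rewrite /sample /= -mulr_sumr (Lr _).2 mulr1.
- move=> v v' vv'; apply/funext => -[f h] /=; case: ifP => // /forallP fk.
  by rewrite /sample; congr (_ * L _ _); apply/ffunP => i; rewrite !ffunE vv'.
- move=> x E; rewrite !sum_pair_pred /=; apply: le_trans (lerD (lexx _) hit).
  rewrite [X in _ + X]big_mkcond -big_split /=; apply: ler_sum => f _.
  case: (miss f) => /=; first by rewrite addr0.
  rewrite (big1 _ _ (fun h => 0)) // add0r /sample /= -mulr_sumr ler_piMr //.
  by rewrite -[leRHS](Lr [ffun i => x (f i)]).2 [leRHS](bigID (fun h => E (f, h))) /= lerDl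
    sumr_ge0 // => h _; apply: (Lr _).1.
Qed.

Definition pushforward (pt : I -> Z) : {ffun Z -> R} := [ffun z => \sum_(o | pt o == z) w o].

Lemma pushforward_pmf pt : is_pmf (pushforward pt).
Proof.
split=> [z|]; first by rewrite ffunE sumr_ge0.
by rewrite -w1 (partition_big pt xpredT) //=; apply: eq_bigr => z _; rewrite ffunE.
Qed.

Lemma error_pushforward pt c h :
  error (pushforward pt) c h = \sum_(o | h (pt o) != c (pt o)) w o.
Proof.
rewrite (partition_big pt (fun z => h z != c z)) //; apply: eq_bigr => z hz.
by rewrite ffunE; apply: eq_bigl => o; case: eqP => [->|]; rewrite ?hz ?andbF.
Qed.

Lemma sum_pushforward pt (F : {ffun 'I_n -> Z} -> R) :
  \sum_(zs : {ffun 'I_n -> Z}) (\prod_i pushforward pt (zs i)) * F zs =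
  \sum_(f : {ffun 'I_n -> I}) (\prod_i w (f i)) * F [ffun i => pt (f i)].
Proof.
rewrite [RHS](partition_big (fun f : {ffun 'I_n -> I} => [ffun i => pt (f i)]) xpredT) //=.
apply: eq_bigr => zs _.
under eq_bigr => i _ do rewrite ffunE.
rewrite (bigA_distr_big_dep (fun i o => pt o == zs i)) mulr_suml.
apply: eq_big => [f|f /familyP fz].
  apply/familyP/eqP => [fz|<- i]; last by rewrite unfold_in ffunE.
  by apply/ffunP => i; rewrite ffunE; apply/eqP; exact: fz.
by congr (_ * F _); apply/ffunP => i; rewrite ffunE; apply/esym/eqP; exact: fz.
Qed.
End Sampling.

(** * From an accurate proper learner to good outputs on most axes *)

Lemma sum_option (R : realType) (J : finType) (F : option J -> R) :
  \sum_o F o = F None + \sum_j F (Some j).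
Proof.
rewrite (bigD1 None) //=; congr (_ + _).
rewrite (@reindex_omap _ _ _ _ _ Some id) => [//|]; last by case.
by apply: eq_bigl => o; rewrite eqxx.
Qed.

Section AxisReduction.
Variables (R : realType) (d : Order.disp_t) (T : finOrderType d) (t0 : T) (l M n : nat).
Hypothesis t0_min : forall x, (t0 <= x)%O.

Let I := option ('I_l * 'I_M).
Let Z := {ffun 'I_l -> T}.

(* None is the origin, Some (j, k) the k-th row of axis j. *)
Definition axis_weight (pi : R) (o : I) : R :=
  if o is Some _ then pi else 1 - pi * (l * M)%:R.

Definition axis_row (v : 'I_l * 'I_M -> T * bool) (o : I) : Z * bool :=
  if o is Some jk then ([ffun j => if j == jk.1 then (v jk).1 else t0], (v jk).2)
  else ([ffun => t0], true).

Definition axis_decode (h : {ffun Z -> bool}) : Z :=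
  odflt [ffun => t0] [pick a | h == thresh a].

Lemma axis_weight_sum pi : \sum_o axis_weight pi o = 1.
Proof.
by rewrite sum_option /= sumr_const card_prod !card_ord -[pi *+ _]mulr_natr subrK.
Qed.

(** Off the axis the coordinates hold the minimum [t0], which passes every threshold. *)
Lemma thresh_axis_row v jk (a : Z) :
  thresh a (axis_row v (Some jk)).1 = ((v jk).1 <= a jk.1)%O.
Proof.
rewrite ffunE; apply/forallP/idP => [/(_ jk.1)|va j]; first by rewrite ffunE eqxx.
by rewrite ffunE; case: eqP => [->|].
Qed.

(** A bad axis contributes error at least [pi * M / 2 = 4 * alpha / l], so at most [l / 4] axes are
    bad. *)
Lemma accurate_good_axes (pi alpha : R) (D : 'I_l -> 'I_M -> T * bool) (c : Z)
    (h : {ffun Z -> bool}) :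
  (0 < l)%N -> (0 < M)%N -> 0 < alpha -> pi * (l * M)%:R = 8 * alpha ->
  (forall o, 0 <= axis_weight pi o) ->
  (forall j, axis_labelled (D j) (c j)) -> THRESH h ->
  error (pushforward (axis_weight pi) (fun o => (axis_row (fun jk => D jk.1 jk.2) o).1))
    (thresh c) h <= alpha ->
  3 / 4 * l%:R <= \sum_j (axis_good (D j) (axis_decode h j))%:R :> R.
Proof.
move=> l0 M0 a0 pilM w0 Dc Ch; rewrite error_pushforward.
have hE : h = thresh (axis_decode h).
  rewrite /axis_decode; case: pickP => [a /eqP //|no].
  by move/existsP: Ch => [b]; rewrite no.
move: (axis_decode h) hE => a {Ch} ->.
rewrite big_mkcond sum_option => err.
have {err} : \sum_(jk : 'I_l * 'I_M)
    (if (D jk.1 jk.2).1 <= a jk.1 != (D jk.1 jk.2).2 then pi else 0)%O <= alpha.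
  apply: le_trans err; rewrite -[leLHS]add0r lerD //; first by case: ifP.
  by apply: ler_sum => jk _; rewrite !thresh_axis_row -Dc.
rewrite sum_pair_pred /=.
have pi0 : 0 < pi.
  by move: pilM; rewrite -(pmulr_lgt0 _ (_ : 0 < (l * M)%:R)) ?ltr0n ?muln_gt0 ?l0 // => ->; lra.
have step j : pi * (M%:R / 2) * (1 - (axis_good (D j) (a j))%:R) <=
    \sum_k (if ((D j k).1 <= a j)%O != (D j k).2 then pi else 0).
  rewrite -big_mkcond sumr_const -[leRHS]mulr_natr -mulrA ler_wpM2l ?(ltW pi0) //.
  rewrite /axis_good; case: ltnP => [_|]; first by rewrite subrr mulr0.
  rewrite -(ler_nat R) natrM mulr0n => mM; lra.
move=> err.
have : pi * (M%:R / 2) * (l%:R - \sum_j (axis_good (D j) (a j))%:R) <= alpha.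
  apply: le_trans err; apply: le_trans (ler_sum _ (fun j _ => step j)).
  by rewrite -mulr_sumr sumrB sumr_const card_ord.
have : (0 : R) < l%:R by rewrite ltr0n.
have : (0 : R) < M%:R by rewrite ltr0n.
move: pilM; rewrite natrM; set G := \sum_j _; set m := M%:R; set L := l%:R => pilM m0 L0 h1.
have h2 : 4 * alpha * (L - G) <= alpha * L.
  rewrite (_ : 4 * alpha * (L - G) = (pi * (m / 2) * (L - G)) * L); last by
    rewrite (_ : 4 * alpha = pi * (L * m) / 2); [field | lra].
  by rewrite ler_wpM2r ?(ltW L0).
have : 4 * (L - G) <= L by rewrite -(ler_pM2l a0) mulrCA mulrA.
lra.
Qed.

(** The expected number of good axes is counted twice: accuracy gives at least
    [7/8 * 3/4 * l = 21/32 * l], hardness at most [l] times the right-hand side. *)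
Lemma axis_reduction (pi alpha beta gamma K De : R) (L : learner R Z n) (Y : finType)
    (D : Y -> 'I_M -> T * bool) (c : Y -> T) :
  (0 < l)%N -> (0 < M)%N -> 0 < alpha -> pi * (l * M)%:R = 8 * alpha ->
  (forall o, 0 <= axis_weight pi o) ->
  learner_randomized L -> learner_proper (@THRESH d T l) L ->
  learner_accurate (@THRESH d T l) L alpha (1 / 8) ->
  (0 < #|Y|)%N -> (forall y, axis_labelled (D y) (c y)) -> hard_axis beta gamma D ->
  (forall jk, dominated K De (sample (axis_weight pi) L) (Some jk)) ->
  21 / 32 <= beta * K + gamma * De.
Proof.
move=> l0 M0 a0 pilM w0 Lr Lp La Y0 Dc Dhard dom.
pose P v := sample (axis_weight pi) L (axis_row v).
have P0 v w : 0 <= P v w by apply: sample_ge0.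
have Pdom jk : dominated K De P jk.
  apply: (@dominated_comp _ _ _ _ _ _ _ _ _ (Some jk) jk axis_row) => // v v' vv' o.
  case: o => //= jk' jj.
  by rewrite vv' //; apply: contraNneq jj => ->.
pose rows (e : {ffun 'I_l -> Y}) (jk : 'I_l * 'I_M) := D (e jk.1) jk.2.
pose N : R := #|{ffun 'I_l -> Y}|%:R.
have N0 : 0 < N by rewrite ltr0n card_ffun expn_gt0 Y0.
have upper : \sum_j \sum_(e : {ffun 'I_l -> Y}) \sum_(w | axis_good (D (e j)) (axis_decode w.2 j))
    P (rows e) w <= l%:R * (N * (beta * K + gamma * De)).
  rewrite mulr_natl -[X in _ *+ X](card_ord l) -sumr_const; apply: ler_sum => j _.
  exact: (@hard_axis_product _ _ _ _ _ _ _ _ _ _ _ (fun w => axis_decode w.2)).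
suff : l%:R * (N * (21 / 32)) <= l%:R * (N * (beta * K + gamma * De)).
  by rewrite !ler_pM2l // ltr0n.
apply: le_trans upper; rewrite exchange_big /=.
rewrite mulrCA {1}/N -sumr_const mulr_suml; apply: ler_sum => e _; rewrite mul1r.
pose G (h : {ffun Z -> bool}) : R := \sum_j (axis_good (D (e j)) (axis_decode h j))%:R.
have -> : \sum_j \sum_(w | axis_good (D (e j)) (axis_decode w.2 j)) P (rows e) w =
    \sum_w P (rows e) w * G w.2.
  under eq_bigr do rewrite big_mkcond; rewrite exchange_big; apply: eq_bigr => w _.
  rewrite mulr_sumr; apply: eq_bigr => j _.
  by case: ifP => _; rewrite ?mulr1 ?mulr0.
pose pt o := (axis_row (rows e) o).1.
pose cc : Z := [ffun j => c (e j)].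
have cC : THRESH (thresh cc) by apply/existsP; exists cc.
have := La _ cC _ (pushforward_pmf w0 (axis_weight_sum pi) pt).
rewrite (@sum_pushforward _ _ _ _ _ _ (fun zs => \sum_(h | error _ _ h <= alpha)
   L [ffun i => (zs i, thresh cc (zs i))] h)) => acc.
have G0 h : 0 <= G h by apply: sumr_ge0.
rewrite sum_pair_pred /=.
apply: le_trans (_ : 7 / 8 * (3 / 4 * l%:R) <= _); first lra.
have l3 : (0 : R) <= 3 / 4 * l%:R by rewrite mulr_ge0 // ler0n.
apply: (@le_trans _ _ (_ * (3 / 4 * l%:R))).
  apply: (ler_wpM2r l3); apply: le_trans acc; lra.
rewrite mulr_suml; apply: ler_sum => f _.
rewrite /P /sample /=; under [leRHS]eq_bigr do rewrite -mulrA.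
rewrite -[leRHS]mulr_sumr -[leLHS]mulrA ler_wpM2l ?prodr_ge0 //.
have -> : [ffun i => ([ffun i => pt (f i)] i, thresh cc ([ffun i => pt (f i)] i))] =
    [ffun i => axis_row (rows e) (f i)] :> database Z n.
  apply/ffunP => i; rewrite !ffunE /pt; case: (f i) => [jk|].
    rewrite -(ffunE (fun x : Z => [forall i, (x i <= cc i)%O])) -/(thresh cc) thresh_axis_row.
    by rewrite ffunE -Dc /rows /=.
  by congr (_, _); apply/forallP => j; rewrite ffunE.
set S := [ffun i => axis_row _ _].
rewrite mulr_suml big_mkcond; apply: ler_sum => h _.
have Lh := (Lr S).1 h; case: ifP => [herr|_]; last by rewrite mulr_ge0.
(* Properness speaks only of hypotheses of positive probability; the others contribute nothing. *)
have := Lh; rewrite le_eqVlt => /orP[/eqP <-|Lpos]; first by rewrite !mul0r.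
rewrite ler_wpM2l //.
apply: (@accurate_good_axes pi alpha (fun j => D (e j)) cc) => //; last exact: Lp Lpos.
by move=> j k; rewrite ffunE; apply: Dc.
Qed.
End AxisReduction.

(** * Towers and the iterated logarithm *)

Lemma logstar_fuel_le (R : realType) (j k : nat) (x : R) :
  x <= (tower 2 j)%:R -> (logstar_fuel k x <= j)%N.
Proof.
elim: j k x => [|j IH] [|k] x //= xj; first by rewrite xj.
case: ifPn => // /negbTE; rewrite leNgt => /negbFE x1.
have ln2 : 0 < ln (2 : R) by rewrite ln_gt0 // ltr1n.
apply: IH; rewrite ler_pdivrMr // mulr_natl -lnXn // -natrX ler_ln ?posrE //.
exact: lt_trans x1.
Qed.

Lemma leq_tower2 (j k : nat) : (j <= k)%N -> (tower 2 j <= tower 2 k)%N.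
Proof.
move=> /subnK <-; elim: (k - j)%N => // i IH; apply: leq_trans IH _.
by rewrite addSn /= ltnW // ltn_expl.
Qed.

(** One level in base [b] costs three binary levels: with [b] and [S] at most [t],
    [b ^ S <= t ^ t <= 2 ^ (t * t)], where [t * t <= 2 ^ (2 * t)] and [2 * t <= 2 ^ t]. *)
Lemma tower_base_change (b j M : nat) :
  (b <= tower 2 j)%N -> (tower b M <= tower 2 (j + 3 * M))%N.
Proof.
move=> bj; elim: M => [|M IH].
  by rewrite muln0 addn0; apply: (@leq_tower2 0).
rewrite (_ : (j + 3 * M.+1 = (j + 3 * M).+3)%N) /=; last by lia.
have {}bj : (b <= tower 2 (j + 3 * M))%N.
  by apply: leq_trans bj _; apply: leq_tower2; rewrite leq_addr.
move: IH bj; set t := tower 2 _; set S := tower b M => St bt.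
have t0 : (0 < t)%N by apply: (@leq_tower2 0).
apply: (@leq_trans (t ^ t)).
  case: (posnP S) => [->|S0]; first by rewrite expn_gt0 t0.
  by apply: leq_trans (leq_pexp2l t0 St); rewrite leq_exp2r.
apply: (@leq_trans ((2 ^ t) ^ t)); first by rewrite leq_exp2r // ltnW // ltn_expl.
rewrite -expnM leq_exp2l //; apply: (@leq_trans (2 ^ t * 2 ^ t)).
  by rewrite leq_mul // ltnW // ltn_expl.
rewrite -expnD leq_exp2l // addnn -mul2n -(prednK t0) expnS leq_mul2l /=.
exact: ltn_expl.
Qed.

Lemma self_lt_tower2 (j : nat) : (j < tower 2 j)%N.
Proof. by elim: j => //= j IH; apply: leq_ltn_trans IH _; apply: ltn_expl. Qed.

Lemma privacy_slack_ge0 (R : realType) (Z : finType) (n : nat) (delta : R) (L : learner R Z n)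
    (S : database Z n) : (0 < n)%N -> diff_private (1 / 2) delta L -> 0 <= delta.
Proof.
move=> n0 /(_ S S) Lp; have /Lp /(_ finset.set0) : neighbors S S by exists (Ordinal n0).
by rewrite !big_set0 mulr0 add0r.
Qed.

(** * Choice of parameters and conclusion *)

Theorem theorem6p2 (R : realType) :
  exists c : R, 0 < c /\ exists alpha0 : R, 0 < alpha0 /\
  forall (n l : nat) (alpha delta : R) (d : Order.disp_t) (T : finOrderType d)
         (L : learner R {ffun 'I_l -> T} n),
    0 < alpha -> alpha <= alpha0 ->
    delta * (1500 * (n ^ 2)%:R) <= (l ^ 2)%:R ->
    learner_randomized L ->
    learner_proper (@THRESH d T l) L ->
    diff_private (1 / 2) delta L ->
    learner_accurate (@THRESH d T l) L alpha (1 / 8) ->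
    c * ((l%:R / alpha) * (logstar R #|T|)%:R) <= n%:R.
Proof.
(* [2584 = 38 * 68]: below, [logstar] is at most [38 * m], and [m <= 4 * tau + 1 <= 68 * tau] once
   [tau >= 1 / 64]. *)
exists (1 / 2584); split; first lra.
(* This keeps the weight [1 - 8 * alpha] of the origin nonnegative and the final [delta] term
   small. *)
exists (1 / 16); split; first lra.
move=> n l alpha delta d T L a0 a1 ddelta Lr Lp Lpriv La.
case: (posnP l) => [->|l0]; first by rewrite mul0r mul0r mulr0 ler0n.
case: (leqP #|T| 1) => [T1|T1].
  have -> : logstar R #|T| = 0%N.
    by apply/eqP; rewrite -leqn0; apply: logstar_fuel_le; rewrite ler_nat.
  by rewrite !mulr0 ler0n.
have [t0 t0_min] : exists t0 : T, forall x, (t0 <= x)%O.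
  have [t [rank [rankK rankE]]] := ranking (ltnW T1).
  by exists (t 0%N) => x; rewrite rankE rankK // ltnW.
have lR : 0 < l%:R :> R by rewrite ltr0n.
pose pi (M : nat) : R := 8 * alpha / (l * M)%:R.
have piE M : (0 < M)%N -> pi M * (l * M)%:R = 8 * alpha.
  by move=> M0; rewrite /pi divfK // pnatr_eq0 muln_eq0 negb_or -!lt0n l0.
have w0 M : (0 < M)%N -> forall o : option ('I_l * 'I_M), 0 <= axis_weight (pi M) o.
  move=> M0 [jk|] /=; last by rewrite piE //; lra.
  by rewrite /pi divr_ge0 ?ler0n // mulr_ge0 // ltW.
have reduction M (M0 : (0 < M)%N) := fun beta gamma K De Y D c =>
  @axis_reduction R d T t0 l M n t0_min (pi M) alpha beta gamma K De L Y D c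
    l0 M0 a0 (piE M M0) (w0 M M0) Lr Lp La.
(* With one row per axis, [n * pi 1 = 8 * tau < 1 / 8], and [1 / 2 + 1 / 8] falls short of
   [21 / 32]. *)
have [small|big] := ltP (n%:R * alpha / l%:R) (1 / 64).
  have [D [c [Dc Dhard]]] := hard_axis_single R T1.
  have := reduction 1%N isT _ _ 1 (n%:R * pi 1%N) _ D c _ Dc Dhard.
  rewrite card_bool => /(_ isT) red.
  have {}red : 21 / 32 <= 1 / 2 * 1 + 1 * (n%:R * pi 1%N).
    apply: red => jk; apply: dominated_sample_rare => //; [exact: w0 | exact: axis_weight_sum].
  have e : n%:R * pi 1%N = 8 * (n%:R * alpha / l%:R) by rewrite /pi muln1; ring.
  by move: red; rewrite e; lra.
(* This [m] exceeds [4 * tau], so with [2 * m] rows per axis a row is drawn [4 * tau / m <= 1] times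
   on average. *)
pose m := (Num.truncn (4 * (n%:R * alpha / l%:R))).+1.
have tau0 : 0 <= 4 * (n%:R * alpha / l%:R) by lra.
have /andP[m_ge m_le] := Num.Theory.truncn_itv tau0.
have mtau : 4 * (n%:R * alpha / l%:R) <= m%:R by apply: ltW.
have taum : m%:R <= 4 * (n%:R * alpha / l%:R) + 1 by rewrite /m -natr1 lerD2r.
have m0 : 0 < m%:R :> R by rewrite ltr0n.
have n0 : (0 < n)%N by rewrite lt0n; apply: contraTneq big => ->; rewrite !mul0r -ltNge; lra.
have nR : 0 < n%:R :> R by rewrite ltr0n.
have nal : n%:R * alpha / l%:R * l%:R = n%:R * alpha by rewrite divfK // gt_eqF.
move: (n%:R * alpha / l%:R) nal mtau taum big {tau0 m_ge m_le} => tau nal mtau taum big.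
case: (leqP #|T| (tower (16 * (2 * m)) (2 * m))) => [Tle|Tgt].
  have : (logstar R #|T| <= 16 * (2 * m) + 3 * (2 * m))%N.
    apply: logstar_fuel_le; rewrite ler_nat; apply: leq_trans Tle _.
    by apply: tower_base_change; apply/ltnW/self_lt_tower2.
  rewrite -(ler_nat R) natrD !natrM => lsm.
  have ls_tau : (logstar R #|T|)%:R <= 2584 * tau by lra.
  rewrite [leLHS](_ : _ = l%:R * (logstar R #|T|)%:R / 2584 / alpha); last by lra.
  rewrite ler_pdivrMr // -nal; have := ler_wpM2l (ltW lR) ls_tau; lra.
exfalso.
(* The base [16 * (2 * m)] makes the guessing term [beta * K] equal to [4 / 16]. *)
have [Y [D [c [Y0 Dc Dhard]]]] := @hard_axis_tower R d T (16 * (2 * m)) m isT isT Tgt.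
have delta0 : 0 <= delta := privacy_slack_ge0 [ffun=> ([ffun=> t0], true)] n0 Lpriv.
have := reduction (2 * m)%N isT _ _ 4 (4 * delta) Y D c Y0 Dc Dhard.
have npi : n%:R * pi (2 * m)%N <= 1.
  rewrite (_ : _ * _ = 4 * tau / m%:R); last first.
    rewrite /pi !natrM (_ : n%:R * _ = 8 * (n%:R * alpha) / (l%:R * (2 * m%:R))); last by ring.
    by rewrite -nal; field; rewrite !gt_eqF.
  by rewrite ler_pdivrMr // mul1r.
have b4 : (2 * m)%:R / (16 * (2 * m))%:R * 4 = 1 / 4 :> R.
  rewrite !natrM; field; rewrite gt_eqF //.
rewrite b4 => red.
have {}red : 21 / 32 <= 1 / 4 + (2 * m)%:R * (4 * delta).
  apply: red => jk; apply: (dominated_sample_private _ _ _ ([ffun=> t0], true)) => //.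
  - exact: w0.
  - exact: axis_weight_sum.
move: red ddelta; rewrite natrM !natrX; set x := n%:R in nR nal *; set y := l%:R in lR nal *.
set k := m%:R in m0 mtau taum * => red ddelta.
have ky : k * y <= 68 * (x * alpha) by rewrite -nal mulrA ler_wpM2r ?(ltW lR) //; lra.
have yx : y <= 64 * (x * alpha) by rewrite -nal mulrA ler_peMl ?(ltW lR) //; lra.
(* Here [4352 = 68 * 64], from [m * l ^ 2 <= 68 * 64 * (n * alpha) ^ 2]. *)
have dk : delta * k * 1500 <= 4352 * alpha ^+ 2.
  rewrite -(@ler_pM2r _ (x ^+ 2)) ?exprn_gt0 //.
  have h1 := ler_wpM2l (ltW m0) ddelta.
  have h2 := ler_wpM2r (ltW lR) ky.
  have h3 := ler_wpM2l (ltW (mulr_gt0 nR a0)) yx.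
  lra.
have : alpha ^+ 2 <= (1 / 16) ^+ 2 by rewrite lerXn2r ?nnegrE ?(ltW a0) //; lra.
lra.
Qed.
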